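(* Let $b\in C^1_\sharp(Y_d)^d$ and let $u_0\in C^1(\mathbb{R}^d)$. For $\varepsilon>0$, let $u_\varepsilon$ be the solution of the transport equation with oscillating velocity $$\frac{\partial u_\varepsilon}{\partial t}-b(x/\varepsilon)\cdot\nabla u_\varepsilon=0\ \text{ in }(0,\infty)\times\mathbb{R}^d,\qquad u_\varepsilon(0,x)=u_0(x)\ \text{ for }x\in\mathbb{R}^d.$$ Assume that there exists a vector $\zeta\in\mathbb{R}^d$ such that $$\forall\,x\in Y_d,\quad \lim_{t\to\infty}\frac{X(t,x)}{t}=\zeta,$$ where $X$ is the flow associated with $b$. Then, as $\varepsilon\to0$, $u_\varepsilon$ converges strongly in $L^p_{\rm loc}([0,\infty)\times\mathbb{R}^d)$, for any $p\in[1,\infty)$, to the function $(t,x)\mapsto u_0(x+t\,\zeta)$, which is the solution to the transport equation with the constant velocity $\zeta$ in place of $b(x/\varepsilon)$, namely $\partial_t u-\zeta\cdot\nabla u=0$ in $(0,\infty)\times\mathbb{R}^d$, $u(0,\cdot)=u_0$.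
   Context: $Y_d=\mathbb{R}^d/\mathbb{Z}^d$ is the $d$-dimensional torus, identified with $[0,1)^d$. $C^1_\sharp(Y_d)$ is the space of real-valued $\mathbb{Z}^d$-periodic functions in $C^1(\mathbb{R}^d)$. The flow $X:\mathbb{R}\times\mathbb{R}^d\to\mathbb{R}^d$ associated with $b\in C^1_\sharp(Y_d)^d$ is the solution of $\partial_t X(t,x)=b(X(t,x))$, $t\in\mathbb{R}$, $X(0,x)=x$; it satisfies $X(t,x+\kappa)=X(t,x)+\kappa$ for $\kappa\in\mathbb{Z}^d$. *)

(* Defs.v *)
From HB Require Import structures.
From mathcomp Require Import all_boot all_order all_algebra.
From mathcomp Require Import all_classical all_reals all_analysis.

Set Implicit Arguments.
Unset Strict Implicit.
Unset Printing Implicit Defensive.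
Import Order.TTheory GRing.Theory Num.Theory.
Import numFieldNormedType.Exports.
Local Open Scope classical_set_scope.
Local Open Scope ring_scope.

(* The sigma-algebra on row vectors mirrors the library's one on tuples: it is
   generated by the coordinates.  Over R it is the Borel sigma-algebra. *)

Definition measure_rV_display : measure_display -> measure_display.
Proof. exact. Qed.

Section measurable_rV.
Context {d} {T : measurableType d}.
Variable n : nat.

Let coord (i : 'I_n) (x : 'rV[T]_n) : T := x ord0 i.

Let rV_set0 : g_sigma_preimage coord set0.
Proof. exact: sigma_algebra0. Qed.

Let rV_setC A : g_sigma_preimage coord A -> g_sigma_preimage coord (~` A).
Proof. exact: sigma_algebraC. Qed.

Let rV_bigcup (F : _^nat) : (forall i, g_sigma_preimage coord (F i)) ->
  g_sigma_preimage coord (\bigcup_i (F i)).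
Proof. exact: sigma_algebra_bigcup. Qed.

HB.instance Definition _ := @isMeasurable.Build (measure_rV_display d)
  'rV[T]_n (g_sigma_preimage coord) rV_set0 rV_setC rV_bigcup.

End measurable_rV.

Section measurable_fun_rV.
Context {d d'} {T : measurableType d} {T' : measurableType d'}.

Lemma measurable_coord n (i : 'I_n) :
  measurable_fun [set: 'rV[T]_n] (fun x : 'rV[T]_n => x ord0 i).
Proof.
move=> _ Y mY; rewrite setTI; apply: sub_sigma_algebra => /=.
rewrite -bigcup_seq/=; exists i => /=; first by rewrite mem_index_enum.
by exists Y => //; rewrite setTI.
Qed.

Lemma measurable_fun_rV n (f : T' -> 'rV[T]_n) :
  (forall i, measurable_fun [set: T'] (fun x => f x ord0 i)) ->
  measurable_fun [set: T'] f.
Proof.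
move=> mf; apply: (@measurability _ _ _ _ setT f
  (\big[setU/set0]_(i < n) preimage_set_system [set: 'rV[T]_n]
     (fun x : 'rV[T]_n => x ord0 i) measurable)) => //.
move=> _ [A + <-]; rewrite -bigcup_seq => -[i _ [B mB <-]].
by rewrite setTI; have := mf i measurableT B mB; rewrite !setTI.
Qed.

End measurable_fun_rV.

Section cons_rV.
Context (T : Type) (n : nat).

Definition cons_rV (z : T * 'rV[T]_n) : 'rV[T]_n.+1 :=
  \row_i (if unlift ord0 i is Some j then z.2 ord0 j else z.1).

Definition uncons_rV (x : 'rV[T]_n.+1) : T * 'rV[T]_n :=
  (x ord0 ord0, \row_j x ord0 (lift ord0 j)).

Lemma cons_rV0 z : cons_rV z ord0 ord0 = z.1.
Proof. by rewrite mxE unlift_none. Qed.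

Lemma cons_rVS z i : cons_rV z ord0 (lift ord0 i) = z.2 ord0 i.
Proof. by rewrite mxE liftK. Qed.

Lemma cons_rVK : cancel cons_rV uncons_rV.
Proof.
move=> [t x]; rewrite /uncons_rV cons_rV0; congr pair.
by apply/rowP => i; rewrite mxE cons_rVS.
Qed.

Lemma uncons_rVK : cancel uncons_rV cons_rV.
Proof.
move=> x; apply/rowP => i; have [j ->|->] := unliftP ord0 i.
  by rewrite cons_rVS mxE.
by rewrite cons_rV0.
Qed.

End cons_rV.

Section cons_measure.
Context {R : realType} (n : nat).
Variable mu : {sigma_finite_measure set 'rV[R]_n -> \bar R}.
Local Open Scope ereal_scope.

Let C : measurableTypeR R * 'rV[R]_n -> 'rV[R]_n.+1 := @cons_rV R n.
Let U : 'rV[R]_n.+1 -> measurableTypeR R * 'rV[R]_n := @uncons_rV R n.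

Let measurable_C : measurable_fun setT C.
Proof.
apply: measurable_fun_rV => i; have [j ->|->] := unliftP ord0 i.
  under eq_fun do rewrite cons_rVS.
  exact: (measurableT_comp (measurable_coord j) measurable_snd).
by under eq_fun do rewrite cons_rV0; exact: measurable_fst.
Qed.

Let measurable_U : measurable_fun setT U.
Proof.
apply/measurable_fun_pairP; split; first exact: measurable_coord.
apply: measurable_fun_rV => i; under eq_fun do rewrite mxE.
exact: measurable_coord.
Qed.

Definition cons_measure : set 'rV[R]_n.+1 -> \bar R :=
  pushforward (@lebesgue_measure R \x mu) C.

Let cons_measure0 : cons_measure set0 = 0.
Proof. by rewrite /cons_measure /pushforward preimage_set0 measure0. Qed.

Let cons_measure_ge0 A : 0 <= cons_measure A.
Proof. exact: measure_ge0. Qed.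

Let cons_measure_sigma_additive : semi_sigma_additive cons_measure.
Proof.
exact: (@measure_semi_sigma_additive _ _ _
  (@pushforward _ _ _ _ R (@lebesgue_measure R \x mu) C)).
Qed.

HB.instance Definition _ := isMeasure.Build _ _ _ cons_measure
  cons_measure0 cons_measure_ge0 cons_measure_sigma_additive.

Lemma cons_measureE (A : set (measurableTypeR R)) (B : set 'rV[R]_n) :
  measurable A -> measurable B ->
  cons_measure (U @^-1` (A `*` B)) = lebesgue_measure A * mu B.
Proof.
move=> mA mB; rewrite /cons_measure /pushforward -product_measure1E//.
rewrite -comp_preimage (_ : U \o C = id)//.
by apply/funext => z; exact: cons_rVK.
Qed.

Let cons_measure_sigma_finite : sigma_finite setT cons_measure.
Proof.
have /sigma_finiteP[F [TF ndF Foo]] := sigma_finiteT (@lebesgue_measure R).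
have /sigma_finiteP[G [TG ndG Goo]] := sigma_finiteT mu.
exists (fun k => U @^-1` (F k `*` G k)).
  rewrite -preimage_bigcup -[LHS](preimage_setT U) -setXTT TF TG.
  congr (U @^-1` _); apply/seteqP; split => -[x y].
    move=> [/= [k _ Fkx] [l _ Gly]]; exists (maxn k l) => //; split.
    - by move: x Fkx; exact/subsetPset/ndF/leq_maxl.
    - by move: y Gly; exact/subsetPset/ndG/leq_maxr.
  by move=> [k _ []/= ? ?]; split; exists k.
move=> k; have [mF Fk] := Foo k; have [mG Gk] := Goo k; split.
  rewrite -[X in measurable X]setTI.
  by apply: measurable_U => //; exact: measurableX.
by rewrite cons_measureE// lte_mul_pinfty// ge0_fin_numE.
Qed.

HB.instance Definition _ := Measure_isSigmaFinite.Build _ _ _ cons_measure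
  cons_measure_sigma_finite.

End cons_measure.

Fixpoint lebesgue_rV (R : realType) (n : nat) :
    {sigma_finite_measure set 'rV[R]_n -> \bar R} :=
  match n with
  | 0 => dirac (0 : 'rV[R]_0)
  | n'.+1 => cons_measure (lebesgue_rV R n')
  end.

(* Sanity check: this property characterizes the Lebesgue measure on R^n. *)
Lemma lebesgue_rV_box (R : realType) n (A : 'I_n -> set R) :
  (forall i, measurable (A i)) ->
  lebesgue_rV R n [set x | forall i, A i (x ord0 i)] =
  (\prod_(i < n) lebesgue_measure (A i))%E.
Proof.
elim: n A => [|n IHn] A mA.
  by rewrite big_ord0 /= diracE mem_set// => -[].
rewrite big_ord_recl -IHn//.
have mB : measurable [set x : 'rV[R]_n | forall i, A (lift ord0 i) (x ord0 i)].
  rewrite [X in measurable X](_ : _ =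
    \bigcap_i ((fun x : 'rV[R]_n => x ord0 i) @^-1` A (lift ord0 i))).
    apply: fin_bigcap_measurable => // i _.
    by rewrite -[X in measurable X]setTI; exact: measurable_coord.
  by apply/seteqP; split => x /= Ax i => [_|]; exact: Ax.
rewrite -(cons_measureE (lebesgue_rV R n) (mA ord0) mB).
congr (cons_measure _ _); apply/seteqP; split => x /=.
  by move=> Ax; split => //= i; rewrite mxE.
move=> [A0 /= AS] i; have [j ->|->//] := unliftP ord0 i.
by have := AS j; rewrite mxE.
Qed.

(* On a finite-dimensional space, continuity of every directional derivative
   amounts to continuity of the differential. *)
Definition C1_on (R : realType) (V W : normedModType R) (D : set V)
    (f : V -> W) : Prop :=
  forall x, D x -> differentiable f x /\
    forall v, {for x, continuous (fun y => 'D_v f y)}.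

Section transport.
Context {R : realType} {d : nat}.
Implicit Types (a b : 'rV[R]_d -> 'rV[R]_d) (u : R * 'rV[R]_d -> R).

Definition Zd_periodic (W : Type) (f : 'rV[R]_d -> W) : Prop :=
  forall (k : 'rV[int]_d) x, f (x + map_mx intr k) = f x.

(* Fundamental domain representing the torus R^d / Z^d. *)
Definition unit_cell : set 'rV[R]_d := [set x | forall i, 0 <= x ord0 i < 1].

Definition is_flow b (X : R -> 'rV[R]_d -> 'rV[R]_d) : Prop :=
  (forall x, X 0 x = x) /\
  (forall (t : R) x, is_derive t (1 : R) (fun s => X s x) (b (X t x))).

(* Time is the first component. *)
Definition closed_half_space : set (R * 'rV[R]_d) := [set z | 0 <= z.1].
Definition open_half_space : set (R * 'rV[R]_d) := [set z | 0 < z.1].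

(* Classical solution of du/dt - a . grad u = 0 for t > 0, u = u0 at t = 0;
   the values of u at negative times are irrelevant. *)
Definition transport_solution a (u0 : 'rV[R]_d -> R) u : Prop :=
  [/\ {within closed_half_space, continuous u},
      C1_on open_half_space u,
      forall (t : R) x, 0 < t ->
        'D_(1 : R) (fun s => u (s, x)) t -
        \sum_(i < d) a x ord0 i * 'D_(delta_mx ord0 i) (fun y => u (t, y)) x = 0
    & forall x, u (0, x) = u0 x].

(* Lebesgue measure on space-time. *)
Definition lebesgue_tx :
    {measure set (measurableTypeR R * 'rV[R]_d) -> \bar R} :=
  (@lebesgue_measure R \x lebesgue_rV R d)%E.

(* The compact sets K range within D, so that for the closed half-space they
   may touch the initial time t = 0. *)
Definition Lp_loc (D : set (R * 'rV[R]_d)) (p : R) u : Prop :=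
  forall K, compact K -> K `<=` D ->
    measurable_fun (K : set (measurableTypeR R * 'rV[R]_d)) u /\
    finite_norm lebesgue_tx p%:E (u \_ K).

Definition cvg_Lp_loc (D : set (R * 'rV[R]_d)) (p : R) (T : Type)
    (F : set_system T) (w : T -> R * 'rV[R]_d -> R) u : Prop :=
  [/\ \forall s \near F, Lp_loc D p (w s),
      Lp_loc D p u
    & forall K, compact K -> K `<=` D ->
        ('N[lebesgue_tx]_p%:E [EFin \o (fun z => (w s z - u z)%R) \_ K])%E
          @[s --> F] --> 0%E].

End transport.

(* Main.v *)
From HB Require Import structures.
Require Import Defs.
From mathcomp Require Import all_boot all_order all_algebra.
From mathcomp Require Import all_classical all_reals all_analysis.
From mathcomp Require Import measurable_realfun ring lra.
Import Order.TTheory GRing.Theory Num.Theory.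
Import numFieldNormedType.Exports.
Local Open Scope classical_set_scope.
Local Open Scope ring_scope.

(** A solution of a transport equation is constant along backward
    characteristics, so [transport_along_characteristic] forces
    u_eps(t, x) = u0(eps X(t/eps, x/eps)).  With tau = t/eps and y = x/eps,

      eps X(tau, y) - (x + t zeta) = eps (X(tau, y) - y - tau zeta),

    and the whole theorem comes down to bounding the drift
    X(tau, y) - y - tau zeta by o(tau), with an error that does not depend on
    y: the point y = x/eps moves as eps tends to 0, so that the pointwise
    limit assumed for X(t, x)/t does not apply directly.

    Pointwise convergence is however automatically uniform here.  Each
    coordinate S(t, x) of the drift is an additive cocycle over the flow,
    continuous and periodic in x, and Lipschitz in t.  Suppose that S(t, x)
    exceeds e t by an arbitrarily large amount for some t and x.  Restarting
    the orbit where s |-> S(s, x) - e s is minimal on [0, t] gives a point all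
    of whose partial drifts satisfy S(s, y) >= e s up to a time that grows
    with the excess; a cluster point of such y, which exists on the compact
    torus, satisfies S(s, y) >= e s for every s >= 0 and contradicts the
    pointwise limit.  This is [cocycle_uniform_bound]; applied to both signs
    of each coordinate it yields [flow_uniform_drift]:
    |X(t, x) - x - t zeta| <= e t + B for all t >= 0 and all x.

    The cocycle, periodicity and continuity properties of the flow rest on
    uniqueness and continuous dependence for the differential equation, which
    follow from a Gronwall estimate on the squared Euclidean distance
    ([ode_stability]), as a periodic C^1 field is globally Lipschitz.

    Hence u_eps converges to u0(x + t zeta) uniformly on compact sets
    ([oscillating_transport_cvg]), u0 being Lipschitz on balls.  Compact sets
    of space-time are measurable and have finite Lebesgue measure, so that
    uniform convergence on them implies convergence in every L^p_loc with p
    finite ([cvg_uniform_Lp_loc]).  Uniqueness for the limit equation is once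
    more the method of characteristics, now along straight lines. *)

Set Implicit Arguments.
Unset Strict Implicit.
Unset Printing Implicit Defensive.

(** * Derivatives along curves and Lipschitz bounds *)

Lemma is_derive_comp_curve (R : realType) (V W : normedModType R)
    (f : V -> W) (g : R -> V) (t : R) (v : V) :
  differentiable f (g t) -> is_derive t (1 : R) g v ->
  is_derive t (1 : R) (f \o g) ('D_v f (g t)).
Proof.
move=> df [dg <-].
have dg' : differentiable g t by exact/derivable1_diffP.
have dfg : differentiable (f \o g) t by exact: differentiable_comp.
apply: DeriveDef; first exact: diff_derivable.
by rewrite !deriveE// diff_comp.
Qed.

Lemma is_derive_continuous (R : realType) (V : normedModType R)
    (g dg : R -> V) :
  (forall s, is_derive s (1 : R) g (dg s)) -> continuous g.
Proof.
move=> dgs s; apply/differentiable_continuous/derivable1_diffP.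
by have [] := dgs s.
Qed.

Lemma is_derive_coord (R : realType) (n : nat) (g : R -> 'rV[R]_n) (t : R)
    (v : 'rV[R]_n) (i : 'I_n) :
  is_derive t (1 : R) g v ->
  is_derive t (1 : R) (fun s => g s ord0 i) (v ord0 i).
Proof.
move=> [dg <-]; apply: DeriveDef; first exact: (derivable_mxP _ _ _).1.
by rewrite derive_mx// mxE.
Qed.

Lemma C1_coord (R : realType) (V : normedModType R) (n : nat)
    (f : V -> 'rV[R]_n) (i : 'I_n) :
  C1_on setT f -> C1_on setT (fun x => f x ord0 i : R).
Proof.
move=> f1 x _; have [dfx cfx] := f1 x I; split.
  exact: (@differentiable_comp _ _ _ _ f (fun N : 'rV[R]_n => N ord0 i) _ dfx
           (differentiable_coord _ _ _)).
move=> v; rewrite (_ : (fun y => _) = (fun N : 'rV[R]_n => N ord0 i) \o 'D_v f).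
  by apply: continuous_comp (cfx v) _; exact: coord_continuous.
apply/funext => y /=; rewrite derive_mx ?mxE//.
by apply: diff_derivable; have [] := f1 y I.
Qed.

Lemma C1_continuous (R : realType) (V W : normedModType R) (f : V -> W) :
  C1_on setT f -> continuous f.
Proof. by move=> f1 x; apply: differentiable_continuous; have [] := f1 x I. Qed.

Lemma derive_sum_delta (R : realType) (n : nat) (W : normedModType R)
    (f : 'rV[R]_n -> W) (x v : 'rV[R]_n) :
  differentiable f x ->
  'D_v f x = \sum_(i < n) v ord0 i *: 'D_(delta_mx ord0 i) f x.
Proof.
move=> dfx; rewrite deriveE// [in LHS](row_sum_delta v) linear_sum/=.
by apply: eq_bigr => i _; rewrite linearZ deriveE.
Qed.

Lemma coord_le_norm (R : realType) (n : nat) (x : 'rV[R]_n) (i : 'I_n) :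
  `|x ord0 i| <= `|x|.
Proof.
rewrite [leRHS]/Num.Def.normr /= mx_normrE.
exact: (le_bigmax _ (fun ij => `|x ij.1 ij.2|) (ord0, i)).
Qed.

Lemma norm_le_coord (R : realType) (n : nat) (x : 'rV[R]_n) (M : R) :
  0 <= M -> (forall i, `|x ord0 i| <= M) -> `|x| <= M.
Proof.
move=> M0 xM; rewrite [leLHS]/Num.Def.normr /= mx_normrE.
by apply: bigmax_le => // -[j i] _ /=; rewrite ord1.
Qed.

Lemma is_derive_line (R : realType) (V : normedModType R) (x v : V) (t : R) :
  is_derive t (1 : R) (fun s => x + s *: v) v.
Proof.
have dv : is_derive t (1 : R) ( *:%R ^~ v : R -> V) v.
  apply: DeriveDef; first exact: diff_derivable.
  by rewrite deriveE// diff_val scale1r.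
by apply: is_derive_eq; rewrite add0r.
Qed.

Lemma mean_value_bound (R : realType) (n : nat) (f : 'rV[R]_n -> R) (M : R)
    (x y : 'rV[R]_n) :
  (forall z, differentiable f z) ->
  (forall s i, 0 <= s <= 1 ->
     `|'D_(delta_mx ord0 i) f (y + s *: (x - y))| <= M) ->
  `|f x - f y| <= n%:R * M * `|x - y|.
Proof.
move=> df fM.
pose g s := y + s *: (x - y).
have dg s : is_derive s (1 : R) g (x - y) by exact: is_derive_line.
have dfg s : is_derive s (1 : R) (f \o g) ('D_(x - y) f (g s)).
  exact: is_derive_comp_curve.
have [s s01] := @MVT_segment _ (f \o g) (fun s => 'D_(x - y) f (g s)) 0 1 ler01
  (fun s _ => dfg s)
  (continuous_subspaceT (is_derive_continuous dfg)).
rewrite /g /= scale1r scale0r addr0 subrKC subr0 mulr1 => ->.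
rewrite derive_sum_delta// (le_trans (ler_norm_sum _ _ _))//.
have -> : n%:R * M * `|x - y| = \sum_(i < n) M * `|x - y|.
  by rewrite sumr_const card_ord -[RHS]mulr_natl mulrA.
apply: ler_sum => i _; rewrite normrM mulrC ler_pM// ?coord_le_norm//.
by apply: fM; move: s01; rewrite in_itv.
Qed.

(** * Periodic functions *)

Lemma translate_to_unit_cell (R : realType) (d : nat) (x : 'rV[R]_d) :
  exists k : 'rV[int]_d, unit_cell (x + map_mx intr k).
Proof.
exists (\row_i - Num.floor (x ord0 i)) => i; rewrite !mxE mulrNz subr_ge0.
by rewrite ltrBlDr addrC floor_le/= -[X in _ + X]/(1%:~R) -intrD floorD1_gt.
Qed.

Lemma closed_cube_compact (R : realType) (d : nat) (M : R) :
  compact [set x : 'rV[R]_d | forall i, x ord0 i \in `[- M, M]].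
Proof.
by apply: (@rV_compact _ _ (fun=> `[- M, M]%classic)) => i; exact: segment_compact.
Qed.

Lemma unit_cell_sub_cube (R : realType) (d : nat) (x : 'rV[R]_d) :
  unit_cell x -> forall i, x ord0 i \in `[- 1, 1].
Proof.
move=> ux i; have /andP[x0 x1] := ux i; rewrite in_itv/= (ltW x1) andbT.
by rewrite (le_trans _ x0)// lerN10.
Qed.

(** The closed cube [-1, 1]^d is compact and contains a representative of every
    point modulo Z^d. *)
Lemma periodic_bounded (R : realType) (d : nat) (W : normedModType R)
    (f : 'rV[R]_d -> W) :
  continuous f -> Zd_periodic f ->
  exists2 M : R, 0 <= M & forall x, `|f x| <= M.
Proof.
move=> cf pf.
have [M [_ fM]] := compact_bounded (continuous_compact
  (continuous_subspaceT cf) (@closed_cube_compact R d 1)).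
exists (`|M| + 1); first by rewrite addr_ge0.
move=> x; have [k kx] := translate_to_unit_cell x.
rewrite -(pf k x); apply: fM; first by rewrite ltr_pwDr// ler_norm.
exists (x + map_mx intr k) => //; exact: unit_cell_sub_cube.
Qed.

Lemma derive_periodic (R : realType) (d : nat) (W : normedModType R)
    (f : 'rV[R]_d -> W) (v : 'rV[R]_d) :
  Zd_periodic f -> Zd_periodic ('D_v f).
Proof.
move=> pf k x; rewrite /derive; apply: (congr1 (fun g : R -> W => lim (g @ 0^'))).
apply/funext => h /=.
by rewrite addrA !pf.
Qed.

(** A single continuous function that dominates all the partial derivatives at
    once: bounding it avoids choosing one bound for each direction. *)
Lemma C1_sum_norm_derive_continuous (R : realType) (d : nat)
    (W : normedModType R) (f : 'rV[R]_d -> W) :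
  C1_on setT f ->
  continuous (fun x => \sum_(j < d) `|'D_(delta_mx ord0 j) f x|).
Proof.
move=> f1; apply: continuous_big; first exact: add_continuous.
move=> j _ x; have [_ df] := f1 x I.
exact: (continuous_comp (df (delta_mx ord0 j)) (@norm_continuous _ _ _)).
Qed.

Lemma C1_periodic_lipschitz (R : realType) (d n : nat)
    (b : 'rV[R]_d -> 'rV[R]_n) :
  C1_on setT b -> Zd_periodic b ->
  exists2 L : R, 0 <= L & forall x y, `|b x - b y| <= L * `|x - y|.
Proof.
move=> b1 pb.
have [M M0 bM] : exists2 M : R, 0 <= M &
    forall x, `|\sum_(j < d) `|'D_(delta_mx ord0 j) b x| | <= M.
  apply: periodic_bounded; first exact: C1_sum_norm_derive_continuous.
  by move=> k x; apply: eq_bigr => j _; rewrite derive_periodic.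
exists (d%:R * M); first by rewrite mulr_ge0.
move=> x y; apply: norm_le_coord => [|i]; first by rewrite !mulr_ge0.
rewrite !mxE; apply: (mean_value_bound (f := fun x => b x ord0 i)).
  by move=> z; have [] := C1_coord i b1 (x := z) I.
move=> s j _; set z := _ + _.
have dz : derivable b z (delta_mx ord0 j).
  by apply: diff_derivable; have [] := b1 z I.
have -> : 'D_(delta_mx ord0 j) (fun x => b x ord0 i) z =
    ('D_(delta_mx ord0 j) b z) ord0 i by rewrite derive_mx// mxE.
rewrite (le_trans (coord_le_norm _ _))//.
rewrite (le_trans _ (bM z))// [leRHS]ger0_norm ?sumr_ge0//.
by rewrite (bigD1 j)//= lerDl sumr_ge0.
Qed.

Lemma C1_lipschitz_ball (R : realType) (d : nat) (f : 'rV[R]_d -> R) (r : R) :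
  C1_on setT f ->
  exists2 L : R, 0 <= L &
    forall x y, `|x| <= r -> `|y| <= r -> `|f x - f y| <= L * `|x - y|.
Proof.
move=> f1.
have [M [_ fM]] := compact_bounded (continuous_compact
  (continuous_subspaceT (C1_sum_norm_derive_continuous f1))
  (@closed_cube_compact R d r)).
exists (d%:R * (`|M| + 1)); first by rewrite mulr_ge0// addr_ge0.
move=> x y xr yr; apply: mean_value_bound.
  by move=> z; have [] := f1 z I.
move=> s j s01; set z := _ + _.
have zr : `|z| <= r.
  have -> : z = (1 - s) *: y + s *: x.
    by rewrite /z scalerBr scalerBl scale1r -addrA [- _ + _]addrC.
  have /andP[s0 s1] := s01.
  rewrite (le_trans (ler_normD _ _))// !normrZ ger0_norm ?subr_ge0//.
  rewrite ger0_norm//.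
  have : (1 - s) * `|y| + s * `|x| <= (1 - s) * r + s * r.
    by rewrite lerD// ler_wpM2l// subr_ge0.
  by rewrite -mulrDl subrK mul1r.
have gM : `|\sum_(j < d) `|'D_(delta_mx ord0 j) f z| | <= `|M| + 1.
  apply: fM; first by rewrite ltr_pwDr// ler_norm.
  exists z => // i; rewrite in_itv/= -ler_norml.
  by rewrite (le_trans (coord_le_norm _ _)).
rewrite (le_trans _ gM)// [leRHS]ger0_norm ?sumr_ge0//.
by rewrite (bigD1 j)//= lerDl sumr_ge0.
Qed.

(** * The method of characteristics *)

Lemma is_derive_pair (R : realType) (V W : normedModType R)
    (f : R -> V) (g : R -> W) (t : R) (v : V) (w : W) :
  is_derive t (1 : R) f v -> is_derive t (1 : R) g w ->
  is_derive t (1 : R) (fun s => (f s, g s)) (v, w).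
Proof.
move=> [df <-] [dg <-].
have {}df : differentiable f t by exact/derivable1_diffP.
have {}dg : differentiable g t by exact/derivable1_diffP.
have dfg : differentiable (fun s => (f s, g s)) t by exact: differentiable_pair.
apply: DeriveDef; first exact: diff_derivable.
by rewrite !deriveE// diff_pair.
Qed.

Lemma derive_space (R : realType) (U V W : normedModType R) (f : U * V -> W)
    (t : U) (x v : V) :
  'D_v (fun y => f (t, y)) x = 'D_((0, v) : U * V) f (t, x).
Proof.
rewrite /derive; apply: (congr1 (fun g : R -> W => lim (g @ 0^'))).
apply/funext => h /=.
by rewrite -[h *: (0, v)]/(h *: 0, h *: v) -[(_, _) + (_, _)]/(_ + _, _ + _)
  scaler0 add0r.
Qed.

Lemma derive_time (R : realType) (U V W : normedModType R) (f : U * V -> W)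
    (t u : U) (x : V) :
  'D_u (fun s => f (s, x)) t = 'D_((u, 0) : U * V) f (t, x).
Proof.
rewrite /derive; apply: (congr1 (fun g : R -> W => lim (g @ 0^'))).
apply/funext => h /=.
by rewrite -[h *: (u, 0)]/(h *: u, h *: 0) -[(_, _) + (_, _)]/(_ + _, _ + _)
  scaler0 add0r.
Qed.

(** The function s |-> v(t - s, g s) has derivative
    - dv/dt + a(g s) . grad v = 0 on the open interval, and is continuous up to
    its endpoints, where it takes the two values compared here. *)
Lemma transport_along_characteristic (R : realType) (d : nat)
    (a : 'rV[R]_d -> 'rV[R]_d) (u0 : 'rV[R]_d -> R) (v : R * 'rV[R]_d -> R)
    (g : R -> 'rV[R]_d) (t : R) :
  transport_solution a u0 v ->
  (forall s, is_derive s (1 : R) g (a (g s))) ->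
  0 <= t -> v (t, g 0) = u0 (g t).
Proof.
move=> [cv v1 eqv v0] dg; rewrite le_eqVlt => /predU1P[<-//|t0].
pose c s := (t - s, g s).
have dc s : is_derive s (1 : R) c (-1, a (g s)).
  by apply: is_derive_pair => //; apply: is_derive_eq; rewrite add0r mul1r.
have cc := is_derive_continuous dc.
have dvc s : s \in `]0, t[ -> is_derive s (1 : R) (v \o c) 0.
  rewrite in_itv/= => /andP[s0 st].
  have ts : 0 < t - s by rewrite subr_gt0.
  have [dv _] := v1 (c s) ts.
  apply: is_derive_eq (is_derive_comp_curve dv (dc s)) _.
  (* Both terms of the equation are read as directional derivatives of v in
     space-time, so that linearity of the differential applies. *)
  have := eqv (t - s) (g s) ts; rewrite derive_time.
  have -> : \sum_(i < d) a (g s) ord0 i *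
      'D_(delta_mx ord0 i) (fun y => v (t - s, y)) (g s) =
      'D_((0, a (g s)) : R * 'rV[R]_d) v (c s).
    rewrite -derive_space derive_sum_delta//.
    apply: (@differentiable_comp _ _ _ _ (fun y => (t - s, y)) v) => //.
  rewrite !deriveE// => /eqP; rewrite subr_eq0 => /eqP e.
  rewrite -[(-1, a (g s))]/((-1 : R, a (g s)) : R * 'rV[R]_d).
  have -> : (-1 : R, a (g s)) = (0, a (g s)) - (1, 0) :> R * 'rV[R]_d.
    by rewrite -[(_, _) - (_, _)]/(_ - _, _ - _) sub0r subr0.
  by rewrite linearB/= e subrr.
have cvc : {within `[0, t], continuous (v \o c)}.
  apply/subspace_continuousP => s st A /=.
  have cs0 : closed_half_space (c s).
    by move: st; rewrite /= in_itv/= /closed_half_space/= subr_ge0 => /andP[].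
  move/subspace_continuousP : cv => /(_ _ cs0) /[apply].
  rewrite nbhs_simpl/= => vA.
  have {}vA : \forall r \near s, closed_half_space (c r) -> A (v (c r)).
    exact: (cc s _ vA).
  change (\forall r \near s, `[0, t]%classic r -> A (v (c r))).
  apply: filterS vA => r vAr rt; apply: vAr.
  by move: rt; rewrite /= in_itv/= /closed_half_space/= subr_ge0 => /andP[].
have [s _ /eqP] := MVT t0 dvc cvc.
by rewrite mul0r subr_eq0 /= /c subrr subr0 v0 => /eqP.
Qed.

(** * Stability of the differential equation and properties of the flow *)

(** The product of E with exp(- K s) has a nonpositive derivative. *)
Lemma gronwall (R : realType) (E dE : R -> R) (K t : R) :
  (forall s, is_derive s (1 : R) E (dE s)) ->
  (forall s, dE s <= K * E s) ->
  0 <= t -> E t <= E 0 * expR (K * t).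
Proof.
move=> dE_ dEK t0.
pose F s := E s * expR (s * - K).
have dF s : is_derive s (1 : R) F ((dE s - K * E s) * expR (s * - K)).
  have dK : is_derive s (1 : R) (fun r => expR (r * - K))
      (- K * expR (s * - K)).
    have dl : is_derive s (1 : R) (fun r => r * - K) (- K).
      by have := is_derive_line 0 (- K) s; under eq_fun do rewrite add0r.
    apply: is_derive_eq (is_derive_comp_curve (f := expR) _ dl) _.
      exact/derivable1_diffP/derivable_expR.
    by rewrite -[X in 'D_X _ _]mulr1 deriveE ?linearZ/= -?deriveE ?derive_val//;
      exact/derivable1_diffP/derivable_expR.
  apply: is_derive_eq; rewrite /GRing.scale/=.
  by ring.
have [s _ h] := MVT_segment t0 (fun s _ => dF s)
  (continuous_subspaceT (is_derive_continuous dF)).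
have : F t <= F 0.
  rewrite -subr_le0 h subr0 mulr_le0_ge0// mulr_le0_ge0 ?expR_ge0//.
  by rewrite subr_le0.
by rewrite /F mul0r expR0 mulr1 mulrN expRN ler_pdivrMr ?expR_gt0// [K * t]mulrC.
Qed.

Lemma curve_lipschitz (R : realType) (n : nat) (g dg : R -> 'rV[R]_n) (M : R) :
  (forall s, is_derive s (1 : R) g (dg s)) -> (forall s, `|dg s| <= M) ->
  forall s t, `|g t - g s| <= M * `|t - s|.
Proof.
move=> dg_ dgM.
suff : forall s t, s <= t -> `|g t - g s| <= M * `|t - s|.
  move=> h s t; have [|/ltW] := leP s t; first exact: h.
  by move=> /h; rewrite distrC [X in _ * X]distrC.
move=> s t st.
have M0 : 0 <= M by apply: le_trans (dgM 0).
apply: norm_le_coord => [|i]; first by rewrite mulr_ge0.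
pose gi r := g r ord0 i.
have dgi r : is_derive r (1 : R) gi (dg r ord0 i) by exact: is_derive_coord.
have [r _ h] := MVT_segment st (fun s _ => dgi s)
  (continuous_subspaceT (is_derive_continuous dgi)).
rewrite !mxE -/(gi t) -/(gi s) h normrM ler_wpM2r//.
exact: le_trans (coord_le_norm _ _) _.
Qed.

(** The sup norm is not differentiable, so Gronwall is applied to the squared
    Euclidean distance E.  Since b is L-Lipschitz for the sup norm,
    |E'| <= 2 d L |Y - Z|^2 <= 2 d L E, which gives the exponent; the factor
    d + 1 is a crude bound for the ratio of the two norms. *)
Lemma ode_stability (R : realType) (d : nat) (b : 'rV[R]_d -> 'rV[R]_d) (L : R)
    (Y Z : R -> 'rV[R]_d) (t : R) :
  0 <= L -> (forall x y, `|b x - b y| <= L * `|x - y|) ->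
  (forall s, is_derive s (1 : R) Y (b (Y s))) ->
  (forall s, is_derive s (1 : R) Z (b (Z s))) ->
  0 <= t ->
  `|Y t - Z t| <= d.+1%:R * expR (2 * d%:R * L * t) * `|Y 0 - Z 0|.
Proof.
move=> L0 bL dY dZ t0; set K := 2 * d%:R * L.
pose E s := \sum_(i < d) (Y s ord0 i - Z s ord0 i) ^+ 2.
pose dE s := \sum_(i < d) 2 * (Y s ord0 i - Z s ord0 i) *
  (b (Y s) ord0 i - b (Z s) ord0 i).
have YZ s i : `|Y s ord0 i - Z s ord0 i| <= `|Y s - Z s|.
  by have := coord_le_norm (Y s - Z s) i; rewrite !mxE.
have EE : E = \sum_(i < d) ((fun s => Y s ord0 i) - (fun s => Z s ord0 i)) ^+ 2.
  by apply/funext => r; rewrite fct_sumE.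
have dE_ s : is_derive s (1 : R) E (dE s).
  rewrite EE; apply: is_derive_sum => i.
  have dYi := is_derive_coord i (dY s).
  have dZi := is_derive_coord i (dZ s).
  apply: is_derive_eq; rewrite expr1 /GRing.scale/=.
  by [].
have Ele s : `|Y s - Z s| ^+ 2 <= E s.
  have E0 : 0 <= E s by apply: sumr_ge0 => i _; rewrite sqr_ge0.
  rewrite -(sqr_sqrtr E0) ler_pXn2r ?nnegrE ?sqrtr_ge0//.
  apply: norm_le_coord => [|i]; first exact: sqrtr_ge0.
  rewrite -(ler_pXn2r (n := 2)) ?nnegrE ?sqrtr_ge0// sqr_sqrtr// !mxE.
  rewrite real_normK ?num_real// /E (bigD1 i)//= lerDl.
  by apply: sumr_ge0 => j _; rewrite sqr_ge0.
have dEK s : dE s <= K * E s.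
  apply: (@le_trans _ _ (K * `|Y s - Z s| ^+ 2)); last first.
    by rewrite ler_wpM2l// /K !mulr_ge0.
  have -> : K * `|Y s - Z s| ^+ 2 =
      \sum_(i < d) 2 * `|Y s - Z s| * (L * `|Y s - Z s|).
    rewrite sumr_const card_ord -[RHS]mulr_natl /K.
    by ring.
  apply: ler_sum => i _; rewrite (le_trans (ler_norm _))// !normrM.
  rewrite ger0_norm// -!mulrA ler_wpM2l// ler_pM//.
  apply: le_trans (bL _ _).
  by have := coord_le_norm (b (Y s) - b (Z s)) i; rewrite !mxE.
have E0 : E 0 <= d%:R * `|Y 0 - Z 0| ^+ 2.
  have -> : d%:R * `|Y 0 - Z 0| ^+ 2 = \sum_(i < d) `|Y 0 - Z 0| ^+ 2.
    by rewrite sumr_const card_ord -[RHS]mulr_natl.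
  apply: ler_sum => i _; rewrite -real_normK ?num_real//.
  by rewrite ler_pXn2r ?nnegrE.
have e1 : 1 <= expR (K * t) by rewrite -expR0 ler_expR /K !mulr_ge0.
rewrite -(ler_pXn2r (n := 2)) ?nnegrE ?mulr_ge0 ?expR_ge0//.
apply: le_trans (Ele t) _.
apply: le_trans (gronwall dE_ dEK t0) _.
rewrite 2!exprMn mulrAC ler_pM ?expR_ge0//.
  by apply: sumr_ge0 => i _; rewrite sqr_ge0.
  apply: le_trans E0 _; rewrite ler_wpM2r ?sqr_ge0//.
  by rewrite -natrX ler_nat (leq_trans (leqnSn d))// leq_pmull.
by rewrite expr2 ler_peMl// expR_ge0.
Qed.

Section flow.
Context (R : realType) (d : nat).
Variables (b : 'rV[R]_d -> 'rV[R]_d) (X : R -> 'rV[R]_d -> 'rV[R]_d) (L : R).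
Hypotheses (L0 : 0 <= L) (bL : forall x y, `|b x - b y| <= L * `|x - y|).
Hypothesis flowX : is_flow b X.

Lemma ode_unique (Y Z : R -> 'rV[R]_d) (t : R) :
  (forall s, is_derive s (1 : R) Y (b (Y s))) ->
  (forall s, is_derive s (1 : R) Z (b (Z s))) ->
  Y 0 = Z 0 -> 0 <= t -> Y t = Z t.
Proof.
move=> dY dZ YZ0 t0; have := ode_stability L0 bL dY dZ t0.
by rewrite YZ0 subrr normr0 mulr0 normr_le0 subr_eq0 => /eqP.
Qed.

(** The field is autonomous, so that a time translate of an orbit is again an
    orbit. *)
Lemma flow_semigroup (s t : R) (x : 'rV[R]_d) :
  0 <= t -> X (t + s) x = X t (X s x).
Proof.
have [X0 dX] := flowX.
apply: (ode_unique (Y := fun r => X (r + s) x) (Z := X^~ (X s x))) => //.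
  move=> r.
  have ds : is_derive r (1 : R) (fun q => q + s) (1 : R).
    have := is_derive_line s (1 : R) r.
    by under eq_fun do rewrite [_ *: _]mulr1 addrC.
  have [dXr vXr] := dX (r + s) x.
  apply: is_derive_eq (is_derive_comp_curve (f := X^~ x) _ ds) vXr.
  exact/derivable1_diffP.
by rewrite add0r X0.
Qed.

Lemma flow_translate (k : 'rV[int]_d) (t : R) (x : 'rV[R]_d) :
  Zd_periodic b -> 0 <= t -> X t (x + map_mx intr k) = X t x + map_mx intr k.
Proof.
move=> pb; have [X0 dX] := flowX.
apply: (ode_unique (Y := X^~ _) (Z := fun r => X r x + map_mx intr k)) => //.
  move=> s; have dXs := dX s x.
  by apply: is_derive_eq; rewrite addr0 pb.
by rewrite !X0.
Qed.

Lemma flow_continuous (t : R) : 0 <= t -> continuous (X t).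
Proof.
move=> t0 x; have [X0 dX] := flowX.
apply/(@cvgrPdist_le _ _ _ _ (nbhs_filter x)) => e e0.
set C := d.+1%:R * expR (2 * d%:R * L * t).
have C0 : 0 < C by rewrite mulr_gt0// expR_gt0.
have xe : \forall y \near x, `|x - y| <= C^-1 * e.
  apply: (@cvgr_dist_le _ _ _ _ (nbhs_filter x) id x cvg_id).
  by rewrite mulr_gt0 ?invr_gt0.
apply: filterS xe => y xy.
have := ode_stability L0 bL (dX ^~ x) (dX ^~ y) t0.
by rewrite !X0 -/C => /le_trans; apply; rewrite -ler_pdivlMl.
Qed.

End flow.

(** * Uniform sublinearity of the drift *)

(** Why a pointwise sublinear cocycle is uniformly so.  If S(t, x) > e t + C n,
    let m be a minimum point on [0, t] of h(s) = S(s, x) - e s.  Since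
    h(m) <= h(0) = 0, the cocycle still has to grow by more than C n on [m, t],
    which takes a time t - m >= n; and minimality says that the orbit restarted
    from phi m x satisfies S(s, .) >= e s during that time.  Letting n grow, a
    cluster point of these restarting points has S(s, .) >= e s for ever.
    Only an upper bound on S is derived; the lower bound is the same statement
    for the opposite cocycle.  The set K stands for the compact quotient on
    which S lives. *)
Lemma cocycle_uniform_bound (R : realType) (T : topologicalType) (K : set T)
    (phi : R -> T -> T) (S : R -> T -> R) (C : R) :
  compact K -> 0 <= C ->
  (forall x, exists2 y, K y & forall t, 0 <= t -> S t y = S t x) ->
  (forall s t x, 0 <= s -> 0 <= t -> S (t + s) x = S s x + S t (phi s x)) ->
  (forall t, 0 <= t -> continuous (S t)) ->
  (forall x s t, `|S t x - S s x| <= C * `|t - s|) ->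
  (forall x, S 0 x = 0) ->
  (forall x e, 0 < e -> exists2 t, 0 <= t & S t x < e * t) ->
  forall e, 0 < e -> exists2 B, 0 <= B &
    forall t x, 0 <= t -> S t x <= e * t + B.
Proof.
move=> cK C0 Krep cocS ctsS lipS S0 limS e e0; apply: contrapT => noB.
have run (n : nat) : exists y, K y /\ forall s, 0 <= s <= n%:R -> e * s <= S s y.
  have [t [x [t0 Stx]]] : exists t x, 0 <= t /\ e * t + C * n%:R < S t x.
    apply: contrapT => h; apply: noB.
    exists (C * n%:R); first by rewrite mulr_ge0.
    move=> t x t0; rewrite leNgt; apply/negP => Stx.
    by apply: h; exists t, x.
  pose h s := S s x - e * s.
  have ch : continuous h.
    move=> s; apply: cvgB; last by apply: cvgMr; exact: cvg_id.
    apply/cvgrPdist_le => d d0.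
    have sd : \forall r \near s, `|s - r| <= (C + 1)^-1 * d.
      apply: (@cvgr_dist_le _ _ _ _ (nbhs_filter s) id s cvg_id).
      by rewrite mulr_gt0 ?invr_gt0// ltr_wpDl.
    apply: filterS sd => r; rewrite ler_pdivlMl ?ltr_wpDl// => sr.
    apply: le_trans (lipS _ _ _) (le_trans _ sr).
    by rewrite ler_wpM2r// lerDl.
  have [m] := EVT_min t0 (continuous_subspaceT ch).
  rewrite in_itv/= => /andP[m0 mt] hmin.
  have [y Ky yE] := Krep (phi m x).
  have hm : h m <= 0.
    by rewrite (le_trans (hmin 0 _)) ?in_itv/= ?lexx// /h S0 mulr0 subr0.
  have nt : n%:R <= t - m.
    rewrite leNgt; apply/negP => tn.
    have : S t x - S m x <= C * n%:R.
      apply: le_trans (ler_norm _) _; apply: le_trans (lipS _ _ _) _.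
      by rewrite ler_wpM2l// ger0_norm ?subr_ge0// ltW.
    rewrite leNgt => /negP; apply; move: hm; rewrite /h.
    have : e * m <= e * t by rewrite ler_pM2l.
    by lra.
  exists y; split=> // s /andP[s0 sn]; rewrite yE//.
  have sm : s + m \in `[0, t].
    by rewrite in_itv/= addr_ge0//= -lerBrDr (le_trans sn).
  by have := hmin _ sm; rewrite /h cocS// mulrDr; lra.
have [y yP] := choice run.
(* The conditions e s <= S s y are closed in y, hence pass to a cluster
   point z. *)
have [|z [Kz clz]] := cK (y @ \oo) _.
  by exists 0 => // n _; exact: (yP n).1.
have [s s0 Ssz] := limS z e e0.
have [n [/= Sy ny]] : [set y n | n in [set n : nat | s <= n%:R]] `&`
    [set x | S s x < e * s] !=set0.
  apply: clz.
    exists (Num.trunc s).+1 => // n /= sn; exists n => //=.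
    by rewrite (le_trans (ltW (truncnS_gt s)))// ler_nat.
  exact: (cvgr_lt _ (ctsS s s0 z)).
move: Sy => [k sk kn]; move: ny; rewrite -kn ltNge => /negP; apply.
by apply: (yP k).2; rewrite s0.
Qed.

Section drift.
Context (R : realType) (d : nat).
Variables (b : 'rV[R]_d -> 'rV[R]_d) (X : R -> 'rV[R]_d -> 'rV[R]_d).
Variable zeta : 'rV[R]_d.
Hypotheses (b1 : C1_on setT b) (pb : Zd_periodic b) (flowX : is_flow b X).
Hypothesis limX : forall x, unit_cell x -> t^-1 *: X t x @[t --> +oo] --> zeta.

Let drift (i : 'I_d) (t : R) (x : 'rV[R]_d) : R :=
  X t x ord0 i - x ord0 i - t * zeta ord0 i.

Let drift_translate i k t x :
  0 <= t -> drift i t (x + map_mx intr k) = drift i t x.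
Proof.
have [L L0 bL] := C1_periodic_lipschitz b1 pb.
move=> t0; rewrite /drift (flow_translate L0 bL)// !mxE.
by ring.
Qed.

(** The limit is only assumed on the unit cell; the drift is periodic, and on
    the cell the initial position is negligible with respect to t. *)
Let drift_sublinear i x e : 0 < e ->
  exists2 t, 0 < t & `|drift i t x| <= e * t.
Proof.
move=> e0; have [k kx] := translate_to_unit_cell x.
have [t [t0 te tX]] : exists t, [/\ 0 < t, 2 / e <= t &
    `|zeta - t^-1 *: X t (x + map_mx intr k)| <= e / 2].
  have e20 : 0 < e / 2 by rewrite divr_gt0.
  have /cvgrPdist_le/(_ _ e20) near_zeta := limX kx.
  have [t [[? ?] ?]] : exists t, (0 < t /\ 2 / e <= t) /\
      `|zeta - t^-1 *: X t (x + map_mx intr k)| <= e / 2.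
    apply: (@filter_ex _ (pinfty_nbhs R)); near=> t; split; first split.
    - by near: t; apply: nbhs_pinfty_gt; exact: num_real.
    - by near: t; apply: nbhs_pinfty_ge; exact: num_real.
    - by near: t.
  by exists t.
(* One half of e t pays for the distance of X(t, y)/t to zeta, the other half,
   at least 1 by the choice of t, for the coordinate of y. *)
exists t => //; rewrite -(drift_translate i k _ (ltW t0)).
set y := x + _ in kx tX *.
have yi : `|y ord0 i| <= 1.
  by have := unit_cell_sub_cube kx i; rewrite in_itv/= ler_norml.
have {}tX : `|zeta ord0 i - t^-1 * X t y ord0 i| <= e / 2.
  by have := le_trans (coord_le_norm _ i) tX; rewrite !mxE.
have -> : drift i t y = - (t * (zeta ord0 i - t^-1 * X t y ord0 i)) - y ord0 i.
  rewrite /drift; field.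
  by rewrite gt_eqF.
rewrite (le_trans (ler_normB _ _))// normrN normrM gtr0_norm//.
have -> : e * t = t * (e / 2) + e / 2 * t by field.
rewrite lerD ?ler_wpM2l ?(ltW t0)// (le_trans yi)//.
by move: te; rewrite ler_pdivrMr// => te; rewrite mulrAC ler_pdivlMr// mul1r mulrC.
Unshelve. all: by end_near. Qed.

(** The factor c is there to be 1 or -1, which gives both signs. *)
Let drift_bound i (c e : R) : 0 < e ->
  exists2 B, 0 <= B & forall t x, 0 <= t -> c * drift i t x <= e * t + B.
Proof.
have [L L0 bL] := C1_periodic_lipschitz b1 pb.
have [M M0 bM] := periodic_bounded (C1_continuous b1) pb.
have [X0 dX] := flowX.
have ctX := flow_continuous L0 bL flowX.
apply: (cocycle_uniform_bound (phi := X) (S := fun t x => c * drift i t x)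
  (C := `|c| * (M + `|zeta|)) (@closed_cube_compact R d 1)).
- by rewrite mulr_ge0// addr_ge0.
- move=> x; have [k kx] := translate_to_unit_cell x.
  exists (x + map_mx intr k); first exact: unit_cell_sub_cube.
  by move=> t t0; rewrite drift_translate.
- move=> s t x s0 t0.
  rewrite /drift (flow_semigroup L0 bL flowX)//; ring.
- move=> t t0 x.
  apply: (@continuousM _ _ (cst c) (drift i t)); first exact: cst_continuous.
  apply: (@continuousB _ _ _ (fun x => X t x ord0 i - x ord0 i) (cst _));
    last exact: cst_continuous.
  apply: (@continuousB _ _ _ (fun x => X t x ord0 i)); last exact: coord_continuous.
  exact: (@continuous_comp _ _ _ (X t) (fun N : 'rV[R]_d => N ord0 i) x
    (ctX t t0 x) (@coord_continuous _ _ _ _ _ _)).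
- move=> x s t; rewrite -mulrBr normrM -mulrA ler_wpM2l//.
  have -> : drift i t x - drift i s x =
      (X t x - X s x) ord0 i - (t - s) * zeta ord0 i.
    by rewrite /drift !mxE; ring.
  rewrite [leRHS]mulrDl (le_trans (ler_normB _ _))// lerD//.
    rewrite (le_trans (coord_le_norm _ _))//.
    exact: (curve_lipschitz (dX ^~ x)).
  by rewrite normrM mulrC ler_wpM2r ?coord_le_norm.
- by move=> x; rewrite /drift X0; ring.
- move=> x r r0.
  have [|t t0 te] := drift_sublinear i x (e := r / (`|c| + 1)).
    by rewrite divr_gt0// ltr_wpDl.
  exists t; first exact: ltW.
  rewrite (le_lt_trans (ler_norm _))// normrM.
  apply: (@le_lt_trans _ _ (`|c| * (r / (`|c| + 1) * t))).
    by rewrite ler_wpM2l.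
  have -> : `|c| * (r / (`|c| + 1) * t) = (`|c| / (`|c| + 1)) * (r * t).
    by field; rewrite gt_eqF// ltr_wpDl.
  by rewrite gtr_pMl ?mulr_gt0// ltr_pdivrMr ?ltr_wpDl// mul1r ltrDl.
Qed.

Lemma flow_uniform_drift (e : R) : 0 < e ->
  exists2 B, 0 <= B &
    forall t x, 0 <= t -> `|X t x - x - t *: zeta| <= e * t + B.
Proof.
move=> e0.
have /choice[B BP] : forall i, exists B, 0 <= B /\
    forall t x, 0 <= t -> `|drift i t x| <= e * t + B.
  move=> i; have [B1 B10 h1] := drift_bound i 1 e0.
  have [B2 B20 h2] := drift_bound i (-1) e0.
  exists (B1 + B2); split; first exact: addr_ge0.
  move=> t x t0; have := h1 t x t0; have := h2 t x t0.
  by rewrite ler_norml mul1r mulN1r => *; apply/andP; split; lra.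
exists (\sum_i B i); first by apply: sumr_ge0 => i _; exact: (BP i).1.
move=> t x t0; apply: norm_le_coord => [|i].
  rewrite addr_ge0 ?mulr_ge0// ?(ltW e0)//.
  by apply: sumr_ge0 => i _; exact: (BP i).1.
rewrite !mxE; apply: le_trans ((BP i).2 t x t0) _.
rewrite lerD2l (bigD1 i)//= lerDl.
by apply: sumr_ge0 => j _; exact: (BP j).1.
Qed.

End drift.

(** * Measurability and Lebesgue measure on space-time *)

Lemma rat_approx_rV (R : realType) (n : nat) (x : 'rV[R]_n) (e : R) :
  0 < e -> exists r : 'rV[rat]_n, forall i, `|x ord0 i - ratr (r ord0 i)| < e.
Proof.
move=> e0.
have /choice[r rP] : forall i, exists q : rat, `|x ord0 i - ratr q| < e.
  move=> i; have /rat_in_itvoo[q] : x ord0 i - e < x ord0 i + e by lra.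
  rewrite in_itv/= => /andP[h1 h2]; exists q.
  by rewrite ltr_norml; apply/andP; split; lra.
by exists (\row_i r i) => i; rewrite mxE.
Qed.

Section space_time.
Context (R : realType) (d : nat).
Local Notation spacetime := (measurableTypeR R * 'rV[R]_d)%type.

Let rat_box (j : rat * 'rV[rat]_d * nat) : set (R * 'rV[R]_d) :=
  [set z : R * 'rV[R]_d | `|z.1 - ratr j.1.1| < j.2.+1%:R^-1 /\
    forall i, `|z.2 ord0 i - ratr (j.1.2 ord0 i)| < j.2.+1%:R^-1].

Let ball_measurable (c e : R) :
  measurable [set r : measurableTypeR R | `|r - c| < e].
Proof.
rewrite [X in measurable X](_ : _ = `]c - e, c + e[%classic); last first.
  apply/seteqP; split=> r /=; rewrite in_itv/= ltr_norml.
    by move=> /andP[h1 h2]; apply/andP; split; lra.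
  by move=> /andP[h1 h2]; apply/andP; split; lra.
exact: measurable_itv.
Qed.

Let rat_box_measurable j : measurable (rat_box j : set spacetime).
Proof.
rewrite [X in measurable X](_ : _ =
  [set r : measurableTypeR R | `|r - ratr j.1.1| < j.2.+1%:R^-1] `*`
  \bigcap_(i : 'I_d) ((fun x : 'rV[R]_d => x ord0 i) @^-1`
     [set r : measurableTypeR R | `|r - ratr (j.1.2 ord0 i)| < j.2.+1%:R^-1])).
  apply: measurableX; first exact: ball_measurable.
  apply: fin_bigcap_measurable => // i _; rewrite -[X in measurable X]setTI.
  by apply: measurable_coord => //; exact: ball_measurable.
by apply/seteqP; split => [[t x] [/= h1 h2]|[t x] [/= h1 h2]]; split => //= i;
  [move=> _|]; exact: h2.
Qed.

(** The product sigma-algebra is generated by boxes, and an open set is the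
    countable union of the rational boxes that it contains. *)
Lemma open_measurable_spacetime (A : set (R * 'rV[R]_d)) :
  open A -> measurable (A : set spacetime).
Proof.
move=> oA; rewrite [X in measurable X](_ : _ =
  \bigcup_(j in [set j | rat_box j `<=` A]) rat_box j); last first.
  apply/seteqP; split => [z Az|z [j /= jA jz]]; last exact: jA.
  have /nbhs_ballP[e /= e0 eA] : nbhs z A by exact: open_nbhs_nbhs.
  have [n ne] : exists n : nat, 2 * n.+1%:R^-1 < e.
    have e20 : 0 < e / 2 by rewrite divr_gt0.
    have [n _ /(_ n (leqnn n))] := near_infty_natSinv_lt (PosNum e20).
    by rewrite /= ltr_pdivlMr// mulrC => ne; exists n.
  have [w wE] : exists w : R, w = n.+1%:R^-1 by exists n.+1%:R^-1.
  have w0 : 0 < w by rewrite wE invr_gt0.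
  rewrite -wE in ne.
  have [q] : exists q : rat, ratr q \in `](z.1 - w), (z.1 + w)[.
    by apply: rat_in_itvoo; lra.
  rewrite in_itv/= => /andP[h1 h2].
  have [r rz] := rat_approx_rV z.2 w0.
  exists (q, r, n); rewrite /rat_box/= -wE.
    move=> y [/= y1 y2]; apply: eA; split.
      move: y1; rewrite /ball/= !ltr_norml => /andP[? ?]; apply/andP; split; lra.
    split=> // i j; rewrite ord1; have := y2 j; have := rz j.
    by rewrite /ball/= !ltr_norml => /andP[? ?] /andP[? ?]; apply/andP; split; lra.
  split => /=; first by rewrite ltr_norml; apply/andP; split; lra.
  exact: rz.
rewrite bigcup_mkcond; apply: countable_bigcupT_measurable; first exact: countableP.
by move=> j; case: ifP => // _; exact: rat_box_measurable.
Qed.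

Lemma continuous_measurable_spacetime (f : R * 'rV[R]_d -> R) :
  continuous f -> measurable_fun [set: spacetime] f.
Proof.
move=> /continuousP cf; apply: (measurability _ (RGenOpens.measurableE R)).
move=> _ [_ [a [b ->] <-]]; rewrite setTI; apply: open_measurable_spacetime.
exact/cf/interval_open.
Qed.

Lemma compact_measurable_spacetime (K : set (R * 'rV[R]_d)) :
  compact K -> measurable (K : set spacetime).
Proof.
move=> /compact_closed => /(_ (@norm_hausdorff _ _)) => cK.
rewrite -[K]setCK; apply: measurableC; apply: open_measurable_spacetime.
by rewrite openC.
Qed.

(** A compact set lies in a cube, whose measure is a finite product of finite
    lengths. *)
Lemma compact_finite_lebesgue_tx (K : set (R * 'rV[R]_d)) :
  compact K -> (@lebesgue_tx R d K < +oo)%E.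
Proof.
move=> cK; have mK := compact_measurable_spacetime cK.
have [M [_ KM]] := compact_bounded cK.
pose r := `|M| + 1; have {}KM z : K z -> `|z| <= r.
  by apply: KM; rewrite ltr_pwDr// ler_norm.
pose I := [set` `[- r, r]] : set (measurableTypeR R).
pose box : set spacetime := I `*` [set x : 'rV[R]_d | forall i, I (x ord0 i)].
have mI : measurable I by exact: measurable_itv.
have mB : measurable [set x : 'rV[R]_d | forall i, I (x ord0 i)].
  rewrite [X in measurable X](_ : _ =
    \bigcap_i ((fun x : 'rV[R]_d => x ord0 i) @^-1` I)).
    apply: fin_bigcap_measurable => // i _.
    by rewrite -[X in measurable X]setTI; exact: measurable_coord.
  by apply/seteqP; split => x /= Ax i => [_|]; exact: Ax.
apply: (@le_lt_trans _ _ (lebesgue_tx box)).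
  apply: le_measure; rewrite ?inE//; first exact: measurableX.
  move=> [t x] /KM; rewrite /Num.Def.normr/= ge_max => /andP[tr xr].
  split => /=; first by rewrite /I/= in_itv/= -ler_norml.
  by move=> i; rewrite /I/= in_itv/= -ler_norml (le_trans (coord_le_norm _ _)).
have -> : lebesgue_tx box = (lebesgue_measure I *
    lebesgue_rV R d [set x : 'rV[R]_d | forall i, I (x ord0 i)])%E.
  exact: product_measure1E.
have Ioo : (lebesgue_measure I < +oo)%E.
  by rewrite lebesgue_measure_itv/=; case: ifP; rewrite ?ltry.
have Ifin : lebesgue_measure I \is a fin_num by rewrite ge0_fin_numE.
have -> : lebesgue_rV R d [set x : 'rV[R]_d | forall i, I (x ord0 i)] =
    (\prod_(i < d) lebesgue_measure I)%E.
  exact: (@lebesgue_rV_box R d (fun=> I) (fun=> mI)).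
rewrite ltey_eq fin_numM//.
by elim/big_ind : _ => // x y; exact: fin_numM.
Qed.

End space_time.

(** On a set of finite measure, the sup norm controls the p-norm. *)
Lemma Lnorm_restrict_le d (T : measurableType d) (R : realType)
    (mu : {measure set T -> \bar R}) (p : R) (K : set T) (f : T -> R) (M : R) :
  measurable K -> measurable_fun K f -> 0 < p -> 0 <= M ->
  (forall z, K z -> `|f z| <= M) ->
  ('N[mu]_p%:E [EFin \o (f \_ K)] <= M%:E * mu K `^ p^-1)%E.
Proof.
move=> mK mf p0 M0 fM; rewrite unlock /Lnorm.
have -> : (fun x => `|(EFin \o (f \_ K)) x| `^ p)%E =
    (fun x => (`|f x| `^ p)%:E) \_ K.
  apply/funext => x; rewrite /= !patchE; case: ifPn => //= _.
  by rewrite normr0 powR0// gt_eqF.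
rewrite -integral_mkcond.
have le_int : (\int[mu]_(x in K) (`|f x| `^ p)%:E <= (M `^ p)%:E * mu K)%E.
  rewrite -(integral_cst mu mK (M `^ p)%:E); apply: ge0_le_integral => //.
  - apply/measurable_EFinP.
    by apply: (measurableT_comp (measurable_powR p)); exact: measurableT_comp.
  - move=> x Kx; rewrite lee_fin ge0_ler_powR ?nnegrE ?fM//; exact: ltW.
have -> : (M%:E * mu K `^ p^-1 = ((M `^ p)%:E * mu K) `^ p^-1)%E.
  rewrite poweRM ?lee_fin ?powR_ge0// poweR_EFin -powRrM mulfV ?gt_eqF//.
  by rewrite powRr1.
apply: gt0_ler_poweR => //.
- by rewrite invr_ge0 ltW.
- rewrite in_itv/= leey andbT; apply: integral_ge0 => x _.
  by rewrite lee_fin powR_ge0.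
- by rewrite in_itv/= leey andbT mule_ge0// lee_fin powR_ge0.
Qed.

(** * From uniform convergence on compact sets to local L^p convergence *)

Section transport_theorem.
Context (R : realType) (d : nat).
Local Notation spacetime := (measurableTypeR R * 'rV[R]_d)%type.
Local Notation half := (@closed_half_space R d).

(** A function that is only continuous up to the boundary of the half-space
    coincides on it with its composition with the retraction
    (t, x) |-> (max(t, 0), x), which is continuous on the whole space-time. *)
Lemma within_half_space_measurable (f : R * 'rV[R]_d -> R)
    (K : set (R * 'rV[R]_d)) :
  {within half, continuous f} -> compact K -> K `<=` half ->
  measurable_fun (K : set spacetime) f.
Proof.
move=> cf cK Khalf.
pose retract (z : R * 'rV[R]_d) := (Num.max z.1 0, z.2).
have retract_half z : half (retract z) by rewrite /half/= le_max lexx orbT.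
have cretract : continuous retract.
  move=> z.
  have cmax : {for z, continuous (fun z : R * 'rV[R]_d => Num.max z.1 0)}.
    exact: (@continuous_max _ _ fst (cst 0) z (@cvg_fst _ _ _ _ _)
      (@cst_continuous _ _ _ _)).
  exact: (cvg_pair cmax (@cvg_snd _ _ _ _ _)).
have cfr : continuous (f \o retract).
  move=> z A; move/subspace_continuousP : cf => /(_ _ (retract_half z)) /[apply].
  move=> vA; have {}vA : \forall y \near z, half (retract y) -> A (f (retract y)).
    exact: (cretract z _ vA).
  by apply: filterS vA => y; apply; exact: retract_half.
apply: (@eq_measurable_fun _ _ spacetime R K (f \o retract)).
  move=> [t x]; rewrite inE => /Khalf; rewrite /half/= /retract/= => t0.
  by rewrite max_l.
apply: measurable_funTS; exact: continuous_measurable_spacetime.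
Qed.

Lemma within_half_space_Lp_loc (f : R * 'rV[R]_d -> R) (p : R) :
  0 < p -> {within half, continuous f} -> Lp_loc half p f.
Proof.
move=> p0 cf K cK Khalf; have mf := within_half_space_measurable cf cK Khalf.
split=> //.
have [M [_ fM]] := compact_bounded (continuous_compact
  (continuous_subspaceW Khalf cf) cK).
have fM1 z : K z -> `|f z| <= `|M| + 1.
  by move=> Kz; apply: fM; [rewrite ltr_pwDr// ler_norm|exists z].
apply: le_lt_trans (Lnorm_restrict_le _
  (compact_measurable_spacetime cK) mf p0 _ fM1) _.
  by rewrite addr_ge0.
rewrite lte_mul_pinfty ?lee_fin ?addr_ge0// poweR_lty//.
exact: compact_finite_lebesgue_tx.
Qed.

(** If |w s - f| <= e on K, then the p-norm of the difference on K is at most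
    e |K|^(1/p). *)
Lemma cvg_uniform_Lp_loc (T : Type) (F : set_system T) (p : R)
    (w : T -> R * 'rV[R]_d -> R) (f : R * 'rV[R]_d -> R) :
  Filter F -> 0 < p ->
  (\forall s \near F, {within half, continuous (w s)}) ->
  {within half, continuous f} ->
  (forall K, compact K -> K `<=` half -> forall e, 0 < e ->
     \forall s \near F, forall z, K z -> `|w s z - f z| <= e) ->
  cvg_Lp_loc half p F w f.
Proof.
move=> FF p0 cw cf wf; split.
- by apply: filterS cw => s; exact: within_half_space_Lp_loc.
- exact: within_half_space_Lp_loc.
- move=> K cK Khalf.
  have mK := compact_measurable_spacetime cK.
  have cfin : (@lebesgue_tx R d K `^ p^-1)%E \is a fin_num.
    rewrite ge0_fin_numE ?poweR_ge0// poweR_lty//.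
    exact: compact_finite_lebesgue_tx.
  set c := fine (@lebesgue_tx R d K `^ p^-1)%E.
  have c0 : 0 <= c by rewrite fine_ge0// poweR_ge0.
  have bound e : 0 < e -> \forall s \near F, ('N[lebesgue_tx]_p%:E
      [EFin \o (fun z => (w s z - f z)%R) \_ K] <= (e * c)%:E)%E.
    move=> e0; apply: filterS2 cw (wf K cK Khalf e e0) => s cws wfs.
    have mwf : measurable_fun (K : set spacetime) (fun z => w s z - f z).
      by apply: measurable_funB; exact: within_half_space_measurable.
    apply: le_trans (Lnorm_restrict_le lebesgue_tx mK mwf p0
      (ltW e0) wfs) _.
    by rewrite EFinM fineK.
  apply/fine_cvgP; split.
    apply: filterS (bound 1 ltr01) => s Ns.
    by rewrite ge0_fin_numE ?Lnorm_ge0// (le_lt_trans Ns)// ltry.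
  apply/cvgrPdist_le => e e0.
  have e'0 : 0 < e / (c + 1) by rewrite divr_gt0// ltr_wpDl.
  apply: filterS (bound _ e'0) => s Ns.
  rewrite sub0r normrN ger0_norm ?fine_ge0 ?Lnorm_ge0//.
  rewrite -lee_fin fineK; last first.
    by rewrite ge0_fin_numE ?Lnorm_ge0// (le_lt_trans Ns)// ltry.
  apply: le_trans Ns _; rewrite lee_fin mulrAC ler_pdivrMr ?ltr_wpDl//.
  by rewrite ler_wpM2l ?lerDl// ltW.
Qed.

(** * The oscillating equation *)

Section oscillating.
Variables (b : 'rV[R]_d -> 'rV[R]_d) (X : R -> 'rV[R]_d -> 'rV[R]_d).
Variables (u0 : 'rV[R]_d -> R) (zeta : 'rV[R]_d).
Hypotheses (b1 : C1_on setT b) (pb : Zd_periodic b) (flowX : is_flow b X).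
Hypothesis u01 : C1_on setT u0.

(** The rescaled orbit s |-> eps X(s/eps, x/eps) is a characteristic of the
    oscillating field, starting at x. *)
Lemma oscillating_transport_formula (eps : R) (v : R * 'rV[R]_d -> R)
    (t : R) (x : 'rV[R]_d) :
  0 < eps -> transport_solution (fun x => b (eps^-1 *: x)) u0 v -> 0 <= t ->
  v (t, x) = u0 (eps *: X (t / eps) (eps^-1 *: x)).
Proof.
move=> eps0 vsol t0; have [X0 dX] := flowX.
pose g s := eps *: X (s / eps) (eps^-1 *: x).
have g0 : g 0 = x by rewrite /g mul0r X0 scalerA mulfV ?gt_eqF// scale1r.
rewrite -[in LHS]g0; apply: transport_along_characteristic vsol _ t0.
move=> s; rewrite /g scalerA mulVf ?gt_eqF// scale1r.
set y := eps^-1 *: x; have [dXs vXs] := dX (s / eps) y.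
have ds : is_derive s (1 : R) (fun r : R => r / eps) eps^-1.
  by have := is_derive_line 0 eps^-1 s; under eq_fun do rewrite add0r.
have dXs' : differentiable (X^~ y) (s / eps) by exact/derivable1_diffP.
have dcomp := is_derive_comp_curve (g := fun r => r / eps) dXs' ds.
have dZ := is_deriveZ eps dcomp.
apply: is_derive_eq dZ _.
have -> : 'D_eps^-1 (X^~ y) (s / eps) = eps^-1 *: b (X (s / eps) y).
  by rewrite -vXs !deriveE// -linearZ/= [_ *: 1]mulr1.
by rewrite scalerA mulfV ?gt_eqF// scale1r.
Qed.

Hypothesis limX : forall x, unit_cell x -> t^-1 *: X t x @[t --> +oo] --> zeta.

(** The bound e' tau + B on the drift at time tau = t/eps becomes
    e' t + eps B after scaling: e' is chosen so that e' t is at most e/2 for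
    t <= r, and then eps B is small. *)
Lemma oscillating_flow_cvg (r e : R) : 0 <= r -> 0 < e ->
  \forall eps \near 0^'+, forall t x, 0 <= t <= r ->
    `|eps *: X (t / eps) (eps^-1 *: x) - (x + t *: zeta)| <= e.
Proof.
move=> r0 e0.
have e'0 : 0 < e / 2 / (r + 1) by rewrite !divr_gt0// ltr_wpDl.
have [B B0 hB] := flow_uniform_drift b1 pb flowX limX e'0.
near=> eps => t x /andP[t0 tr].
have eps0 : 0 < eps by near: eps; exact: nbhs_right_gt.
have -> : eps *: X (t / eps) (eps^-1 *: x) - (x + t *: zeta) =
    eps *: (X (t / eps) (eps^-1 *: x) - eps^-1 *: x - (t / eps) *: zeta).
  have -> : t *: zeta = eps *: ((t / eps) *: zeta).
    by rewrite scalerA mulrCA mulfV ?gt_eqF// mulr1.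
  set y := eps^-1 *: x; have -> : x = eps *: y.
    by rewrite scalerA mulfV ?gt_eqF// scale1r.
  by rewrite -scalerDr -scalerBr opprD addrA.
rewrite normrZ gtr0_norm//.
have te0 : 0 <= t / eps by rewrite divr_ge0// ltW.
apply: (@le_trans _ _ (eps * (e / 2 / (r + 1) * (t / eps) + B))).
  by rewrite ler_pM2l// hB.
have -> : eps * (e / 2 / (r + 1) * (t / eps) + B) =
    e / 2 * (t / (r + 1)) + eps * B.
  by field; rewrite !gt_eqF// ltr_wpDl.
rewrite [leRHS](_ : e = e / 2 * 1 + e / 2); last by lra.
rewrite lerD//.
  by rewrite ler_pM2l ?divr_gt0// ler_pdivrMr ?ltr_wpDl// mul1r ler_wpDr.
have : eps <= e / 2 / (B + 1).
  by near: eps; apply: nbhs_right_le; rewrite !divr_gt0// ltr_wpDl.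
rewrite ler_pdivlMr ?ltr_wpDl//; apply: le_trans.
by rewrite ler_pM2l// lerDl.
Unshelve. all: by end_near. Qed.

Lemma oscillating_transport_cvg (u : R -> R * 'rV[R]_d -> R)
    (K : set (R * 'rV[R]_d)) (e : R) :
  (forall eps, 0 < eps ->
     transport_solution (fun x => b (eps^-1 *: x)) u0 (u eps)) ->
  compact K -> K `<=` half -> 0 < e ->
  \forall eps \near 0^'+, forall z, K z ->
    `|u eps z - u0 (z.2 + z.1 *: zeta)| <= e.
Proof.
move=> usol cK Khalf e0.
have [M [_ KM]] := compact_bounded cK.
pose r := `|M| + 1; have {}KM z : K z -> `|z| <= r.
  by apply: KM; rewrite ltr_pwDr// ler_norm.
have r0 : 0 <= r by rewrite addr_ge0.
pose rho := r + r * `|zeta| + 1.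
(* The ball of radius rho contains the points x + t zeta for (t, x) in K, with
   a margin of 1 for the rescaled orbits that approach them. *)
have [L L0 u0L] := C1_lipschitz_ball rho u01.
have L1 : 0 < L + 1 by rewrite ltr_wpDl.
have del0 : 0 < Num.min 1 (e / (L + 1)) by rewrite lt_min ltr01 divr_gt0.
near=> eps => -[t x] Ktx /=.
have eps0 : 0 < eps by near: eps; exact: nbhs_right_gt.
have t0 : 0 <= t := Khalf _ Ktx.
have := KM _ Ktx; rewrite [`|(t, x)|]/Num.Def.normr/= ge_max => /andP[tr xr].
rewrite ger0_norm// in tr.
rewrite (oscillating_transport_formula x eps0 (usol _ eps0) t0).
set y := eps *: _.
have : `|y - (x + t *: zeta)| <= Num.min 1 (e / (L + 1)).
  have : 0 <= t <= r by rewrite t0.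
  by move: t x {Ktx t0 tr xr} @y; near: eps; exact: oscillating_flow_cvg.
rewrite le_min => /andP[y1 ye].
have xz : `|x + t *: zeta| <= r + r * `|zeta|.
  rewrite (le_trans (ler_normD _ _))// lerD// normrZ ger0_norm//.
  by rewrite ler_wpM2r.
apply: le_trans (u0L _ _ _ _) _.
- rewrite -[y](subrK (x + t *: zeta)) (le_trans (ler_normD _ _))//.
  by rewrite addrC /rho lerD.
- by rewrite (le_trans xz)// lerDl.
- move: ye; rewrite ler_pdivlMr// mulrC; apply: le_trans.
  by rewrite ler_wpM2r// lerDl.
Unshelve. all: by end_near. Qed.

End oscillating.

(** * The homogenized equation *)

Section constant_velocity.
Variables (u0 : 'rV[R]_d -> R) (zeta : 'rV[R]_d).
Hypothesis u01 : C1_on setT u0.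

Let shift_char (z : R * 'rV[R]_d) : 'rV[R]_d := z.2 + z.1 *: zeta.

Let shift_char_linear : linear shift_char.
Proof.
move=> a [t x] [s y]; rewrite /shift_char/= scalerDr scalerA scalerDl.
by rewrite addrACA.
Qed.

Let shift_char_continuous : continuous shift_char.
Proof.
move=> z; apply: cvgD; first exact: cvg_snd.
by apply: cvgZr_tmp; exact: cvg_fst.
Qed.

Let shift_char_differentiable z : differentiable shift_char z.
Proof.
pose lM := GRing.isLinear.Build _ _ _ _ _ shift_char_linear.
pose lL : {linear _ -> _} := HB.pack shift_char lM.
have -> : shift_char = lL by [].
exact/linear_differentiable/shift_char_continuous.
Qed.

Let derive_shift_char v z :
  'D_v (u0 \o shift_char) z = 'D_(shift_char v) u0 (shift_char z).
Proof.
rewrite /derive; apply: (congr1 (fun g : R -> R => lim (g @ 0^'))).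
by apply/funext => h /=; rewrite shift_char_linear.
Qed.

(** The candidate is u0 composed with the linear map
    (t, x) |-> x + t zeta, which sends the time direction (1, 0) to zeta and
    is the identity on space directions; so the time derivative of u is the
    derivative of u0 along zeta. *)
Lemma constant_transport_solution :
  transport_solution (fun=> zeta) u0 (fun z => u0 (z.2 + z.1 *: zeta)).
Proof.
split.
- apply: continuous_subspaceT => z.
  exact: (continuous_comp (@shift_char_continuous z)
    (C1_continuous u01 (x := shift_char z))).
- move=> z _; split.
    apply: (@differentiable_comp _ _ _ _ shift_char u0) => //.
    by have [] := @u01 (shift_char z) I.
  move=> v; change {for z, continuous ('D_v (u0 \o shift_char))}.
  have -> : 'D_v (u0 \o shift_char) = 'D_(shift_char v) u0 \o shift_char.
    by apply/funext => y; exact: derive_shift_char.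
  have [_ cDu0] := @u01 (shift_char z) I.
  exact: (continuous_comp (@shift_char_continuous z) (cDu0 _)).
- move=> t x t0; rewrite (derive_time (u0 \o shift_char)).
  under eq_bigr do rewrite (derive_space (u0 \o shift_char)) derive_shift_char.
  have -> : 'D_((1, 0) : R * 'rV[R]_d) (u0 \o shift_char) (t, x) =
      'D_zeta u0 (shift_char (t, x)).
    by rewrite derive_shift_char /shift_char/= add0r scale1r.
  have [du0 _] := @u01 (shift_char (t, x)) I.
  rewrite derive_sum_delta//; apply/eqP; rewrite subr_eq0; apply/eqP.
  apply: eq_bigr => i _; congr (_ * 'D_ _ u0 _).
  by rewrite /shift_char/= scale0r addr0.
- by move=> x /=; rewrite scale0r addr0.
Qed.

Lemma constant_transport_unique (v : R * 'rV[R]_d -> R) (t : R) (x : 'rV[R]_d) :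
  transport_solution (fun=> zeta) u0 v -> 0 <= t ->
  v (t, x) = u0 (x + t *: zeta).
Proof.
move=> vsol t0; rewrite -(transport_along_characteristic vsol
  (is_derive_line x zeta) t0).
by rewrite scale0r addr0.
Qed.

End constant_velocity.
End transport_theorem.

Theorem theorem5p1 (R : realType) (d : nat)
    (b : 'rV[R]_d -> 'rV[R]_d) (X : R -> 'rV[R]_d -> 'rV[R]_d)
    (u0 : 'rV[R]_d -> R) (u : R -> R * 'rV[R]_d -> R) (zeta : 'rV[R]_d) :
  C1_on setT b -> Zd_periodic b ->
  C1_on setT u0 ->
  is_flow b X ->
  (forall eps, 0 < eps ->
     transport_solution (fun x => b (eps^-1 *: x)) u0 (u eps)) ->
  (forall x, unit_cell x -> t^-1 *: X t x @[t --> +oo] --> zeta) ->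
  let ubar := fun z : R * 'rV[R]_d => u0 (z.2 + z.1 *: zeta) in
  [/\ forall p : R, 1 <= p ->
        cvg_Lp_loc closed_half_space p 0^'+ u ubar,
      transport_solution (fun=> zeta) u0 ubar
    & forall v, transport_solution (fun=> zeta) u0 v ->
        forall t x, 0 <= t -> v (t, x) = ubar (t, x)].
Proof.
move=> b1 pb u01 flowX usol limX ubar.
have ubar_sol := constant_transport_solution zeta u01.
split=> //; last first.
  by move=> v vsol t x t0; exact: constant_transport_unique vsol t0.
move=> p p1; apply: cvg_uniform_Lp_loc.
- exact: lt_le_trans ltr01 p1.
- near=> eps; have eps0 : 0 < eps by near: eps; exact: nbhs_right_gt.
  by have [] := usol _ eps0.
- by have [] := ubar_sol.
- move=> K cK Khalf e e0.
  exact: (oscillating_transport_cvg b1 pb flowX u01 limX).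
Unshelve. all: by end_near. Qed.
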